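(* Let $G=K_{m_1,\ldots,m_k}$ be a complete multipartite graph with $k\ge 2$, $1\le m_1\le m_2\le\cdots\le m_k$ and $m_k\ge 2$, and let $V$ be its vertex set. Let $\lambda:=|\{i\mid m_i\ge 2\}|$. If $\lambda\ge 2$, then $\operatorname{nim}(\mathrm{DNT}(G))=\operatorname{pty}(V)$.
   Context: For a graph $G$ with vertex set $V$, a set $K\subseteq V$ is convex if it contains every vertex lying on any shortest path between two elements of $K$. The convex hull $[P]$ of $P\subseteq V$ is the smallest convex set containing $P$. For a finite set $A$, $\operatorname{pty}(A):=|A|\bmod 2\in\{0,1\}$. The game $\mathrm{DNT}(G)$: positions are the sets $P\subseteq V$ with $[V\setminus P]=V$; the starting position is $\emptyset$; the options of $P$ are the sets $P\cup\{v\}$ with $v\in V\setminus P$ and $[V\setminus(P\cup\{v\})]=V$. The nim-value of a position is defined recursively by $\operatorname{nim}(p)=\operatorname{mex}\{\operatorname{nim}(q): q\text{ an option of }p\}$, where $\operatorname{mex}(A)$ is the smallest nonnegative integer not in $A$; the nim-value of a game is that of its starting position. *)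

(* Defs.v *)
From mathcomp Require Import all_boot.
From mathcomp Require Import boolp.

Set Implicit Arguments.
Unset Strict Implicit.
Unset Printing Implicit Defensive.

Section Convexity.

(* The adjacency relation e is meant to be symmetric and irreflexive. *)
Variables (V : finType) (e : rel V).
Implicit Types (x y : V) (p q : seq V) (K P : {set V}).

(* The vertices of the path are x :: p; it has size p edges. *)
Definition path_between x y p : bool := path e x p && (last x p == y).

Definition shortest_path x y p : Prop :=
  path_between x y p /\ forall q, path_between x y q -> size p <= size q.

Definition convex K : Prop :=
  forall x y p, x \in K -> y \in K -> shortest_path x y p ->
  {subset x :: p <= K}.

Definition hull P : {set V} :=
  \bigcap_(K : {set V} | `[< convex K >] && (P \subset K)) K.

Lemma hull_sub P : P \subset hull P.
Proof. by apply/bigcapsP => K /andP[]. Qed.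

Lemma hull_convex P : convex (hull P).
Proof.
move=> x y p /bigcapP xH /bigcapP yH xyp z zp.
apply/bigcapP => K cPK; have /andP[/asboolP cK _] := cPK.
exact: cK (xH _ cPK) (yH _ cPK) xyp z zp.
Qed.

Lemma hull_min P K : convex K -> P \subset K -> hull P \subset K.
Proof.
by move=> cK PK; apply: bigcap_inf; rewrite PK andbT; apply/asboolP.
Qed.

End Convexity.

Lemma mex_subproof (A : seq nat) : exists n, n \notin A.
Proof.
exists (\max_(a <- A) a).+1; apply/negP => Am.
by have := @leq_bigmax_seq _ _ xpredT id _ Am isT; rewrite ltnn.
Qed.

Definition mex (A : seq nat) : nat := ex_minn (mex_subproof A).

Section DNT.

Variables (V : finType) (e : rel V).
Implicit Types P Q : {set V}.

Definition dnt_position P : bool := hull e (~: P) == [set: V].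

Definition dnt_options P : {set {set V}} :=
  [set v |: P | v in ~: P & dnt_position (v |: P)].

(* nim_fuel n P is the nim-value of P as soon as n >= #|~: P|, since every move
   shrinks the complement; nimE below is the defining recursion. *)
Fixpoint nim_fuel (n : nat) P : nat :=
  if n is n'.+1 then mex [seq nim_fuel n' Q | Q in dnt_options P] else mex [::].

Definition nim P : nat := nim_fuel #|~: P| P.

Lemma dnt_options_card P Q : Q \in dnt_options P -> #|~: P| = #|~: Q|.+1.
Proof.
case/imsetP => v; rewrite inE => /andP[vP _] ->.
by rewrite setCU setIC -setDE (cardsD1 v (~: P)) vP.
Qed.

Lemma nimE P : nim P = mex [seq nim Q | Q in dnt_options P].
Proof.
rewrite {1}/nim; case cP: #|~: P| => [|n] /=; congr mex.
  rewrite /image_mem (_ : enum _ = [::]) //.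
  apply/eqP; rewrite -size_eq0 -cardE cards_eq0; apply/eqP/setP => Q.
  by rewrite inE; apply/negP => /dnt_options_card; rewrite cP.
apply/eq_in_map => Q; rewrite mem_enum => /dnt_options_card.
by rewrite cP /nim => -[->].
Qed.

Definition nim_DNT : nat := nim set0.

End DNT.

(* K_{m_1,...,m_k}: vertex Tagged _ j with tag i is the j-th vertex of the i-th
   part. *)
Definition multipartite_vertex (k : nat) (m : 'I_k -> nat) : finType :=
  {i : 'I_k & 'I_(m i)}.

Definition multipartite_edge (k : nat) (m : 'I_k -> nat) :
  rel (multipartite_vertex m) := fun u v => tag u != tag v.

Lemma multipartite_edge_sym k (m : 'I_k -> nat) : symmetric (@multipartite_edge k m).
Proof. by move=> u v; rewrite /multipartite_edge eq_sym. Qed.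

Lemma multipartite_edge_irr k (m : 'I_k -> nat) : irreflexive (@multipartite_edge k m).
Proof. by move=> u; rewrite /multipartite_edge eqxx. Qed.

(* Main.v *)
Require Import Defs.
From mathcomp Require Import all_boot.
From mathcomp Require Import boolp.

Set Implicit Arguments.
Unset Strict Implicit.
Unset Printing Implicit Defensive.

(** When two parts have at least two vertices, a set of vertices of a complete
    multipartite graph spans the whole graph exactly when it contains two
    vertices of the same part: such a pair generates every other part, hence a
    pair in another part, which generates the rest; otherwise the set is a
    clique, which is convex. So the play can continue from [P] as long as the
    complement of [P] has a third vertex, and every play stops when exactly two
    vertices are left; the nim-value of a position is then the parity of its
    complement. *)

(** The condition [0 \in A] is guarded by [b] because a position of value 0 may be terminal, whereas
    value 1 requires an option of value 0. *)
Lemma mex_bool (A : seq nat) (b : bool) :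
  {in A, forall a : nat, a = ~~ b} -> (b -> 0 \in A) -> mex A = b.
Proof.
rewrite /mex; case: ex_minnP => n nA nmin Ab A0.
have bA : nat_of_bool b \notin A by apply/negP => /Ab; case: (b).
case: b Ab A0 bA => Ab A0 bA; last by have := nmin _ bA; rewrite leqn0 => /eqP.
apply/eqP; rewrite eqn_leq nmin //= lt0n; apply: contra nA => /eqP ->.
exact: A0.
Qed.

(** Each move flips the parity of the complement, so by induction all options share the value
    opposite to that parity. *)
Lemma nim_parity (V : finType) (e : rel V) :
  (forall P, dnt_position e P -> odd #|~: P| ->
     exists Q, Q \in dnt_options e P) ->
  forall P, dnt_position e P -> nim e P = odd #|~: P|.
Proof.
move=> optE P; move cP: #|~: P| => n.
elim: n P cP => [|n IHn] P cP posP.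
  rewrite nimE; apply: mex_bool => // a /mapP[Q + _].
  by rewrite mem_enum => /dnt_options_card; rewrite cP.
have nimQ Q : Q \in dnt_options e P -> nim e Q = odd n.
  move=> QP; apply: IHn; first by have := dnt_options_card QP; rewrite cP => -[].
  by case/imsetP: QP => v; rewrite inE => /andP[_ ?] ->.
rewrite nimE; apply: mex_bool => [_ /mapP[Q + ->]|oddn].
  by rewrite mem_enum => /nimQ ->; rewrite /= negbK.
have [|Q QP] := optE P posP; first by rewrite cP.
have n_even := negbTE (oddn : ~~ odd n).
by apply/mapP; exists Q; rewrite ?mem_enum // nimQ // n_even.
Qed.

(** A shortest path inside a clique has at most one edge, hence no interior vertex. *)
Lemma clique_convex (V : finType) (e : rel V) (K : {set V}) :
  {in K &, forall x y, x != y -> e x y} -> convex e K.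
Proof.
move=> clK x y p xK yK [/andP[_ /eqP lp] pmin] z.
have: size p <= 1.
  have [xy|xy] := eqVneq x y.
    by apply: leq_trans (pmin [::] _) _; rewrite // /path_between /= xy.
  by apply: (pmin [:: y]); rewrite /path_between /= clK // eqxx.
case: p lp {pmin} => [|w [|//]] /= lp _; rewrite !inE; first by move/eqP ->.
by case/orP => /eqP ->; rewrite // lp.
Qed.

Section Multipartite.

Variables (k : nat) (m : 'I_k -> nat).
Implicit Types (u v w : multipartite_vertex m).
Implicit Types (K P : {set multipartite_vertex m}).

Let e := @multipartite_edge k m.

(** Since [u] and [v] are distinct and not adjacent, the path [u], [w], [v] is a shortest one. *)
Lemma convex_same_part K u v w : convex e K -> u \in K -> v \in K ->
  u != v -> tag u = tag v -> tag w != tag u -> w \in K.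
Proof.
move=> cK uK vK uv tuv wu; apply: (cK u v [:: w; v] uK vK); last first.
  by rewrite !inE eqxx orbT.
split=> [|q /andP[]].
  by rewrite /path_between /= /e /multipartite_edge -tuv eq_sym wu eqxx.
case: q => [|z [|//]] /=; first by rewrite (negPf uv).
by rewrite andbT /e /multipartite_edge => + /eqP zv; rewrite zv tuv eqxx.
Qed.

Lemma part_pair (i : 'I_k) : 2 <= m i ->
  exists u v, [/\ tag u = i, tag v = i & u != v].
Proof.
move=> mi; pose x j := Tagged (fun i => 'I_(m i)) (j : 'I_(m i)).
exists (x (Ordinal (ltnW mi))), (x (Ordinal mi)); split=> //.
by rewrite eq_Tagged.
Qed.

Hypothesis lambda_ge2 : 2 <= #|[set i : 'I_k | 2 <= m i]|.

Lemma dnt_position_multipartiteP P :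
  reflect (exists u v, [/\ u \in ~: P, v \in ~: P, u != v & tag u = tag v])
          (dnt_position e P).
Proof.
have /card_gt1P lambdaP := lambda_ge2.
apply: (iffP eqP) => [hullP|[u [v [uP vP uv tuv]]]];
  have [i [j []]] := lambdaP; rewrite !inE => mi mj ij.
  (* Without such a pair, [~: P] is a clique, so it is its own hull, the whole vertex set; part [i]
     then supplies a pair after all. *)
  case: (pselect (exists u v,
    [/\ u \in ~: P, v \in ~: P, u != v & tag u = tag v])) => // noP.
  have clP : convex e (~: P).
    apply: clique_convex => x y xP yP xy; apply/negP => /eqP txy.
    by apply: noP; exists x, y.
  have inP w : w \in ~: P.
    by apply: (subsetP (hull_min clP (subxx _))); rewrite hullP inE.
  have [u [v [tu tv uv]]] := part_pair mi.
  by case: noP; exists u, v; split; rewrite ?inP // tu tv.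
have cH := @hull_convex _ e (~: P); have /subsetP subH := hull_sub e (~: P).
(* At least one of the large parts [i], [j] is not the part of [u]; its pair [a], [b] will generate
   the part of [u]. *)
have [l ml lu] : exists2 l, 2 <= m l & l != tag u.
  have [iu|] := eqVneq i (tag u); last by exists i.
  by exists j; rewrite // -iu eq_sym.
have [a [b [ta tb ab]]] := part_pair ml.
have offH w : tag w != tag u -> w \in hull e (~: P).
  exact: convex_same_part cH (subH _ uP) (subH _ vP) uv tuv.
apply/setP => w; rewrite [RHS]inE.
have [wu|] := eqVneq (tag w) (tag u); last exact: offH.
by apply: (convex_same_part (u := a) (v := b) cH); rewrite ?offH // ?ta ?tb // wu eq_sym.
Qed.

Lemma odd_multipartite_option P : dnt_position e P -> odd #|~: P| ->
  exists Q, Q \in dnt_options e P.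
Proof.
move=> /dnt_position_multipartiteP[u [v [uP vP uv tuv]]] oddP.
(* An odd set cannot equal the pair [u], [v]; playing a third vertex [w] keeps that pair in the
   complement. *)
have [w] : exists w, w \in ~: P :\: [set u; v].
  apply/set0Pn; rewrite setD_eq0; apply/negP => sub.
  have PE : ~: P = [set u; v].
    by apply/eqP; rewrite eqEsubset sub subUset !sub1set uP vP.
  by move: oddP; rewrite PE cards2 uv.
rewrite in_setD !inE negb_or => /andP[/andP[wu wv] wP].
exists (w |: P); apply/imsetP; exists w => //; rewrite !inE wP /=.
apply/dnt_position_multipartiteP; exists u, v.
by move: uP vP; rewrite !inE !negb_or ![_ == w]eq_sym wu wv.
Qed.

End Multipartite.

Theorem proposition5p10 (k : nat) (m : 'I_k -> nat)
    (k_ge2 : 2 <= k)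
    (m_ge1 : forall i : 'I_k, 1 <= m i)
    (m_sorted : forall i j : 'I_k, i <= j -> m i <= m j)
    (m_last : forall i : 'I_k, i.+1 = k -> 2 <= m i)
    (lambda_ge2 : 2 <= #|[set i : 'I_k | 2 <= m i]|) :
  nim_DNT (@multipartite_edge k m) = #|multipartite_vertex m| %% 2.
Proof.
rewrite /nim_DNT nim_parity; first by rewrite setC0 cardsT modn2.
  exact: odd_multipartite_option.
apply/dnt_position_multipartiteP => //.
(* The empty set is a position: any large part provides the pair. *)
have [i [_ [+ _ _]]] := card_gt1P lambda_ge2; rewrite inE => /part_pair.
by case=> u [v [tu tv uv]]; exists u, v; rewrite !inE tu tv.
Qed.
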